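(* Let $q$ be a prime power, $\varphi>0$ real, $n\ge 1$, $\chi\in\mathcal{N}_q(n)$ and $X=X(\chi)$. Then the composition $\lambda(\chi)\mu(X):\mathbb{C}[B_q(n-1)]\to W(\chi)$ is a linear isomorphism satisfying $\lambda(\chi)\mu(X)\big(q\,\mathcal{A}_{n-1}(v)\big)=\mathcal{A}_{n+1}\big(\lambda(\chi)\mu(X)(v)\big)$ for all $v\in\mathbb{C}[B_q(n-1)]$; in particular $W(\chi)$ is invariant under $\mathcal{A}_{n+1}$.
   Context: $B_q(m)$ denotes the set of subspaces of $\mathbb{F}_q^m$; for a finite-dimensional $\mathbb{F}_q$-space $X$, $B_q(X)$ is its set of subspaces; $\mathbb{C}[S]$ is the complex vector space with basis $S$. $\mathbb{F}_q^m$ is identified with the subspace of $\mathbb{F}_q^{m'}$ ($m<m'$) of vectors whose last $m'-m$ coordinates vanish; $e_1,\dots,e_{n+1}$ is the standard basis. For each $m$, $\mathcal{A}_m$ is the linear operator on $\mathbb{C}[B_q(m)]$ given by $\mathcal{A}_m(Y)=\sum_Z A_m(Z,Y)Z$, where $A_m(Z,Y)=1$ if $Y\subseteq Z$, $\dim Z=\dim Y+1$; $A_m(Z,Y)=\varphi q^{\dim Z}$ if $Z\subseteq Y$, $\dim Y=\dim Z+1$; $A_m(Z,Z)=\frac{\varphi-1}{q-1}q^{\dim Z}$; $0$ otherwise. Let $B^\partial_q(n+1)$ be the set of subspaces of $\mathbb{F}_q^{n+1}$ not contained in $\mathbb{F}_q^n$. Let $H(n+1,\mathbb{F}_q)$ be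 the group of $(n+1)\times(n+1)$ matrices $\begin{pmatrix} I_n & a\\ 0 & 1\end{pmatrix}$, $a\in\mathbb{F}_q^n$, isomorphic to the additive group $\mathbb{F}_q^n$; it permutes $B^\partial_q(n+1)$ and hence acts linearly on $\mathbb{C}[B^\partial_q(n+1)]$. $\mathcal{N}_q(n)$ is the set of nontrivial irreducible (degree one) characters of $H(n+1,\mathbb{F}_q)$. For $\chi\in\mathcal{N}_q(n)$, $W(\chi)\subseteq\mathbb{C}[B^\partial_q(n+1)]\subseteq\mathbb{C}[B_q(n+1)]$ is the isotypic component of $\mathbb{C}[B^\partial_q(n+1)]$ for $\chi$, and $p(\chi)$ is the operator $v\mapsto\sum_{g\in H(n+1,\mathbb{F}_q)}\overline{\chi(g)}\,g v$. For $Y\in B_q(n)$, $\widehat{Y}$ is the span of $Y$ and $e_{n+1}$. It is a fact (used as a definition here) that there is a unique $(n-1)$-dimensional subspace $X(\chi)$ of $\mathbb{F}_q^n$ with $p(\chi)(\widehat{X(\chi)})\neq 0$. For $X=X(\chi)$, $\lambda(\chi):\mathbb{C}[B_q(X)]\to W(\chi)$ is the linear map $Y\mapsto q^{-\dim Y}p(\chi)(\widehat{Y})$. Finally, let $M(X)$ be the unique $n\times(n-1)$ matrix in Schubert normal form (column reduced echelon form: every column nonzero, the last nonzero entry of column $j$ is $1$ in row $r_j$, $r_1<\dots<r_{n-1}$, and rows $r_1,\dots,r_{n-1}$ form the identity matrix) with column space $X$; let $\tau(X):\mathbb{F}_q^{n-1}\to X$ be the linear isomorphism sending $e_j$ to column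 $j$ of $M(X)$, and $\mu(X):\mathbb{C}[B_q(n-1)]\to\mathbb{C}[B_q(X)]$ the linear map $Y\mapsto\tau(X)(Y)$. *)

(* Defs.v *)
From HB Require Import structures.
From mathcomp Require Import all_boot all_order all_algebra.

Set Implicit Arguments.
Unset Strict Implicit.
Unset Printing Implicit Defensive.

Import Order.TTheory GRing.Theory Num.Theory.

Local Open Scope ring_scope.

Section FiniteSubspaces.
Variables (F : finFieldType) (V : vectType F).
Import VectorInternalTheory.

Fact vs2mx_can :
  cancel (fun U : {vspace V} => vs2mx U : 'M[F]_(dim V)) (@mx2vs F V _).
Proof. exact: vs2mxK. Qed.

HB.instance Definition _ := Countable.copy {vspace V} (can_type vs2mx_can).
HB.instance Definition _ :=
  isFinite.Build {vspace V} (pcan_enumP (can_pcan vs2mx_can)).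
End FiniteSubspaces.

(* C[B_q(V)], with B_q(V) = {vspace V}: the coordinates of a vector in the
   basis B_q(V).  F_q^m is 'cV[F]_m and q is #|F|. *)
Notation CB C V := {ffun {vspace V} -> C^o}.

Section FreeVectorSpace.
Variables (C : numClosedFieldType) (S : finType).

Definition bvec (s : S) : {ffun S -> C^o} := [ffun t => (t == s)%:R].

Definition basis_ext_fun (V : vectType C) (f : S -> V)
  (v : {ffun S -> C^o}) : V := \sum_s (v s : C) *: f s.

Lemma basis_ext_is_linear (V : vectType C) (f : S -> V) :
  linear (basis_ext_fun f).
Proof.
move=> a u v; rewrite /basis_ext_fun scaler_sumr -big_split /=.
by apply: eq_bigr => s _; rewrite !ffunE scalerDl scalerA.
Qed.

HB.instance Definition _ (V : vectType C) (f : S -> V) :=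
  GRing.isLinear.Build C {ffun S -> C^o} V _ (basis_ext_fun f)
    (basis_ext_is_linear f).

Definition basis_ext (V : vectType C) (f : S -> V) :
  'Hom({ffun S -> C^o}, V) := linfun (basis_ext_fun f).

Lemma basis_extE (V : vectType C) (f : S -> V) (s : S) :
  basis_ext f (bvec s) = f s.
Proof.
rewrite lfunE /= /basis_ext_fun (bigD1 s) //= big1 ?addr0.
  by rewrite ffunE eqxx scale1r.
by move=> t /negPf ts; rewrite ffunE ts scale0r.
Qed.

End FreeVectorSpace.

Arguments bvec C {S} s.

Section Adjacency.
Variables (C : numClosedFieldType) (F : finFieldType) (m : nat) (phi : C).
Let q : C := #|F|%:R.

Definition A_coef (Z Y : {vspace 'cV[F]_m}) : C :=
  if (Y <= Z)%VS && (\dim Z == (\dim Y).+1) then 1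
  else if (Z <= Y)%VS && (\dim Y == (\dim Z).+1) then phi * q ^+ \dim Z
  else if Z == Y then (phi - 1) / (q - 1) * q ^+ \dim Z
  else 0.

Definition calA : 'End(CB C 'cV[F]_m) :=
  basis_ext (fun Y => \sum_Z A_coef Z Y *: bvec C Z).

End Adjacency.

Arguments calA {C} F m phi.

Section Hgroup.
Variables (F : finFieldType) (n : nat).

Definition Hmx (a : 'cV[F]_n) : 'M[F]_(n + 1) := block_mx 1%:M a 0 1%:M.

Definition Hset : {set 'M[F]_(n + 1)} := [set Hmx a | a : 'cV[F]_n].

Lemma Hmx0 : Hmx 0 = 1%:M.
Proof. by rewrite /Hmx -scalar_mx_block. Qed.

Lemma HmxM a b : Hmx a *m Hmx b = Hmx (a + b).
Proof.
by rewrite /Hmx mulmx_block !mulmx0 !mul0mx !mul1mx !mulmx1 !addr0 add0r addrC.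
Qed.

Lemma Hset1 : 1%:M \in Hset.
Proof. by rewrite -Hmx0 imset_f. Qed.

Lemma HsetM g h : g \in Hset -> h \in Hset -> g *m h \in Hset.
Proof. by move=> /imsetP[a _ ->] /imsetP[b _ ->]; rewrite HmxM imset_f. Qed.

End Hgroup.

Arguments Hset F n : clear implicits.

Section Characters.
Variables (C : numClosedFieldType) (F : finFieldType) (n : nat).

(* H(n+1, F_q) is abelian, so its irreducible characters are its
   homomorphisms to C^*; the values of chi outside Hset are irrelevant. *)
Definition H_char (chi : 'M[F]_(n + 1) -> C) : Prop :=
  chi 1%:M = 1 /\
  {in Hset F n &, forall g h, chi (g *m h) = chi g * chi h}.

Definition nontrivial_H_char (chi : 'M[F]_(n + 1) -> C) : Prop :=
  H_char chi /\ exists2 g, g \in Hset F n & chi g != 1.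

Definition incl_fun (v : 'cV[F]_n) : 'cV[F]_(n + 1) := col_mx v 0.

Lemma incl_is_linear : linear incl_fun.
Proof.
by move=> a u v; rewrite /incl_fun scale_col_mx add_col_mx scaler0 addr0.
Qed.

HB.instance Definition _ :=
  GRing.isLinear.Build F 'cV[F]_n 'cV[F]_(n + 1) _ incl_fun incl_is_linear.

Definition incl : 'Hom('cV[F]_n, 'cV[F]_(n + 1)) := linfun incl_fun.

Definition e_last : 'cV[F]_(n + 1) := col_mx 0 1%:M.

Definition hat (Y : {vspace 'cV[F]_n}) : {vspace 'cV[F]_(n + 1)} :=
  (incl @: Y + <[e_last]>)%VS.

Definition Bbd : {set {vspace 'cV[F]_(n + 1)}} :=
  [set Y | ~~ (Y <= limg incl)%VS].

Definition CBbd : {vspace CB C 'cV[F]_(n + 1)} :=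
  (\sum_(Y in Bbd) <[bvec C Y]>)%VS.

Definition act_sub (g : 'M[F]_(n + 1)) (Y : {vspace 'cV[F]_(n + 1)}) :
  {vspace 'cV[F]_(n + 1)} := (linfun (mulmx g) @: Y)%VS.

Definition act (g : 'M[F]_(n + 1)) : 'End(CB C 'cV[F]_(n + 1)) :=
  basis_ext (fun Y => bvec C (act_sub g Y)).

Definition W (chi : 'M[F]_(n + 1) -> C) : {vspace CB C 'cV[F]_(n + 1)} :=
  (CBbd :&: \bigcap_(g in Hset F n) lker (act g - chi g *: \1%VF))%VS.

Lemma memW (chi : 'M[F]_(n + 1) -> C) v :
  reflect (v \in CBbd /\ {in Hset F n, forall g, act g v = chi g *: v})
          (v \in W chi).
Proof.
have kerE g : (v \in lker (act g - chi g *: \1%VF)) = (act g v == chi g *: v).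
  by rewrite memv_ker add_lfunE opp_lfunE scale_lfunE id_lfunE subr_eq0.
rewrite memv_cap; apply: (iffP andP) => -[vB vW]; split=> //.
  move=> g gH; apply/eqP; rewrite -kerE.
  by apply: subvP vW; move: g gH; apply/subv_bigcapP.
rewrite memvE; apply/subv_bigcapP => g gH; rewrite -memvE kerE.
by rewrite vW.
Qed.

(* W chi is the isotypic component: the sum of all the lines of C[B^bd] that
   are H-submodules affording the degree one character chi. *)
Lemma W_isotypic (chi : 'M[F]_(n + 1) -> C)
    (U : {vspace CB C 'cV[F]_(n + 1)}) :
  (W chi <= U)%VS <->
  forall L : {vspace CB C 'cV[F]_(n + 1)},
    (L <= CBbd)%VS -> \dim L = 1%N ->
    {in Hset F n, forall g, {in L, forall v, act g v = chi g *: v}} ->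
    (L <= U)%VS.
Proof.
split=> [WU L LB _ Lchi | LU].
  apply: subv_trans WU; apply/subvP => v vL; apply/memW; split.
    exact: subvP LB v vL.
  by move=> g gH; apply: Lchi.
apply/subvP => v /memW[vB vchi].
have [->|v0] := eqVneq v 0; first exact: mem0v.
rewrite memvE; apply: LU; rewrite ?dim_vline ?v0 -?memvE // => g gH u.
by move=> /vlineP[k ->]; rewrite linearZ /= vchi // !scalerA mulrC.
Qed.

Definition pchi (chi : 'M[F]_(n + 1) -> C) : 'End(CB C 'cV[F]_(n + 1)) :=
  \sum_(g in Hset F n) (chi g)^* *: act g.

(* X(chi); the default value 0 is never reached for a nontrivial chi. *)
Definition Xchi (chi : 'M[F]_(n + 1) -> C) : {vspace 'cV[F]_n} :=
  odflt 0%VS [pick X : {vspace 'cV[F]_n} |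
    (\dim X == n.-1) && (pchi chi (bvec C (hat X)) != 0)].

(* B_q(X) is the set of subspaces of X seen as a vector space in its own
   right; vsval : subvs_of X -> 'cV[F]_n is the inclusion of X. *)
Definition lambda (chi : 'M[F]_(n + 1) -> C) :
    'Hom(CB C (subvs_of (Xchi chi)), CB C 'cV[F]_(n + 1)) :=
  basis_ext (fun Y : {vspace subvs_of (Xchi chi)} =>
    #|F|%:R ^- \dim Y *: pchi chi (bvec C (hat (linfun vsval @: Y)%VS))).

End Characters.

Section Schubert.
Variables (C : numClosedFieldType) (F : finFieldType) (n : nat).

Definition schubert_form k (M : 'M[F]_(n, k)) : bool :=
  [exists r : {ffun 'I_k -> 'I_n},
    [&& [forall j : 'I_k, forall l : 'I_k, (j < l)%N ==> (r j < r l)%N],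
        [forall j : 'I_k, forall i : 'I_n, (r j < i)%N ==> (M i j == 0)]
      & [forall j : 'I_k, forall l : 'I_k, M (r j) l == (j == l)%:R]]].

(* M(X), for X of dimension n - 1; the default value 0 is never reached. *)
Definition Mmx (X : {vspace 'cV[F]_n}) : 'M[F]_(n, n.-1) :=
  odflt 0 [pick M : 'M[F]_(n, n.-1) |
    schubert_form M && (limg (linfun (mulmx M : 'cV[F]_n.-1 -> 'cV[F]_n)) == X)].

Definition tau (X : {vspace 'cV[F]_n}) : 'Hom('cV[F]_n.-1, subvs_of X) :=
  linfun (vsproj X \o mulmx (Mmx X)).

Definition mu (X : {vspace 'cV[F]_n}) :
    'Hom(CB C 'cV[F]_n.-1, CB C (subvs_of X)) :=
  basis_ext (fun Y => bvec C (tau X @: Y)%VS).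

End Schubert.

Arguments mu C {F n} X.

(* Main.v *)
Require Import Defs.
From mathcomp Require Import all_boot all_order all_algebra.
From mathcomp Require Import complex.
From mathcomp Require Import reals.
From mathcomp Require Import finfield ring.

Set Implicit Arguments.
Unset Strict Implicit.
Unset Printing Implicit Defensive.

Import Order.TTheory GRing.Theory Num.Theory.

Local Open Scope ring_scope.

(* Restricting chi to the group F^n of translations gives a nontrivial additive
   character psi, and the subspaces on which psi is trivial are those of a
   single hyperplane K, so X(chi) = K.
   A subspace Z of F^(n+1) not contained in F^n is determined by Y = Z :&: F^n
   and a vector a, well defined modulo Y, such that (a, 1) is in Z; the
   translation by b replaces a with a + b. Applying p(chi) to this Z gives
   psi(a) p(chi)(hat Y), which vanishes unless Y is contained in K, so the
   p(chi)(hat Y) with Y in K are a basis of W(chi).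
   The operator A_(n+1) commutes with p(chi), so the intertwining relation
   amounts to computing p(chi) (A_(n+1) (hat Y)). Counting every Z once for each
   choice of a, the coefficient of q^(- dim Y') p(chi)(hat Y') becomes a sum of
   psi over Y or Y' (whichever is larger), where psi is 1, that is, q to the
   power dim Y or dim Y'; these powers of q account for the passage from
   A_(n-1) to A_(n+1). *)

(** * Dimensions of sums and images *)

Lemma dim_addv_line (K : fieldType) (V : vectType K) (U : {vspace V}) (v : V) :
  v \notin U -> \dim (U + <[v]>) = (\dim U).+1.
Proof.
move=> vU; rewrite dimv_disjoint_sum.
  rewrite dim_vline; case: eqP vU => [->|_ _]; first by rewrite mem0v.
  by rewrite addn1.
apply/eqP; rewrite -subv0; apply/subvP => w /memv_capP[wU /vlineP[k wE]].
have [k0|k0] := eqVneq k 0; first by rewrite wE k0 scale0r mem0v.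
by case/negP: vU; rewrite -(scalerK k0 v) -wE memvZ.
Qed.

Lemma dim_limg_ker0 (K : fieldType) (V1 V2 : vectType K) (f : 'Hom(V1, V2)) U :
  lker f == 0%VS -> \dim (f @: U) = \dim U.
Proof. by move=> /eqP fK; rewrite limg_dim_eq // fK capv0. Qed.

Lemma dim_cV (K : fieldType) n : \dim {:'cV[K]_n} = n.
Proof. by rewrite dimvf dim_matrix; exact: muln1. Qed.

(** * Additive characters and the hyperplane on which they are trivial *)

Section AdditiveCharacter.
Variables (C : numClosedFieldType) (F : finFieldType) (n : nat).
Variable psi : 'cV[F]_n -> C.
Hypotheses (psi0 : psi 0 = 1) (psiD : {morph psi : a b / a + b >-> a * b}).

(** The value [psi a] is a [p]-th root of unity, [p] being the characteristic of [F]. It therefore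
    has modulus 1, and its conjugate is its inverse. *)
Lemma add_char_conj a : (psi a)^* = psi (- a).
Proof.
have [p p_pr pF] := finPcharP F.
have psiM m : psi (a *+ m) = psi a ^+ m.
  by elim: m => [|m IH]; rewrite ?mulr0n ?expr0 // mulrS exprS psiD IH.
have pa : psi a ^+ p = 1.
  by rewrite -psiM -scaler_nat (pcharf0 pF) scale0r.
have n1 : `|psi a| = 1.
  apply/eqP; rewrite -(@pexpr_eq1 _ _ p) ?prime_gt0 //.
  by rewrite -normrX pa normr1.
have := normCK (psi a); rewrite n1 expr1n => aa.
have a0 : psi a != 0 by rewrite -normr_eq0 n1 oner_eq0.
by apply: (mulfI a0); rewrite -aa -psiD subrr psi0.
Qed.

(** Since [psi] is only additive, the set where it equals 1 need not be stable under scalars. This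
    is the largest [F]-subspace on which [psi] is trivial. *)
Definition char_ker : {vspace 'cV[F]_n} :=
  (\sum_(u | [forall s : F, psi (s *: u) == 1]) <[u]>)%VS.

Lemma mem_char_ker u :
  reflect (forall s, psi (s *: u) = 1) (u \in char_ker).
Proof.
apply: (iffP idP) => [/memv_sumP[w wP ->] | uP]; last first.
  by rewrite memvE; apply: (sumv_sup u) => //; apply/forallP => s; rewrite uP.
move: w wP => w wP.
elim/big_ind: _ => [s|x y xP yP s|i iP s]; first by rewrite scaler0.
  by rewrite scalerDr psiD xP yP mulr1.
have /vlineP[k ->] := wP i iP.
by rewrite scalerA; apply/eqP; move/forallP: iP.
Qed.

Lemma char_kerP (Y : {vspace 'cV[F]_n}) :
  reflect {in Y, forall u, psi u = 1} (Y <= char_ker)%VS.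
Proof.
apply: (iffP subvP) => [YK u uY | Y1 u uY].
  by rewrite -[u]scale1r; apply/mem_char_ker/YK.
by apply/mem_char_ker => s; rewrite Y1 ?memvZ.
Qed.

(* With S(w) the sum of psi over the line spanned by w (indexed by scalars),
   exchanging summations shows that the S(u + t v) add up to q: only the scalar
   0 contributes, as psi is nontrivial on the line of v. So one of them is
   nonzero, and psi is trivial on that line. *)
Lemma char_ker_shift u v :
  v \notin char_ker -> exists t, u + t *: v \in char_ker.
Proof.
move=> vK.
have sum0 w : w \notin char_ker -> \sum_(s : F) psi (s *: w) = 0.
  move=> wK; have [k kw] : exists k, psi (k *: w) != 1.
    apply/existsP; rewrite -negb_forall; apply: contra wK => /forallP wK.
    by apply/mem_char_ker => s; apply/eqP.
  suff : psi (k *: w) * \sum_s psi (s *: w) == \sum_s psi (s *: w).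
    rewrite -subr_eq0 -[X in _ - X]mul1r -mulrBl mulf_eq0 subr_eq0.
    by rewrite (negPf kw) => /eqP.
  rewrite mulr_sumr [X in _ == X](reindex_inj (addrI k)) /=.
  by apply/eqP/eq_bigr => s _; rewrite scalerDl psiD.
have tot : \sum_(t : F) \sum_(s : F) psi (s *: (u + t *: v)) = #|F|%:R.
  rewrite exchange_big /= (bigD1 0) //= [X in _ + X]big1 ?addr0.
    rewrite (eq_bigr (fun=> 1)) ?sumr_const // => t _.
    by rewrite scale0r.
  move=> s s0; rewrite (eq_bigr (fun t => psi (s *: u) * psi (t *: (s *: v)))).
    rewrite -mulr_sumr sum0 ?mulr0 //; apply: contra vK => /(memvZ s^-1).
    by rewrite scalerK.
  by move=> t _; rewrite scalerDr psiD !scalerA mulrC [s * t]mulrC mulrC.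
apply/existsP; apply: contraT; rewrite negb_exists => /forallP noK.
have /eqP := tot; rewrite big1 => [|t _]; last exact: sum0.
by rewrite eq_sym pnatr_eq0 (cardD1 0) inE.
Qed.

(** By [char_ker_shift], the kernel and one vector outside it span the whole space. *)
Lemma dim_char_ker : (exists a, psi a != 1) -> (\dim char_ker).+1 = n.
Proof.
case=> a a1; have aK : a \notin char_ker.
  by apply: contra a1 => /mem_char_ker/(_ 1); rewrite scale1r => ->.
rewrite -(dim_addv_line aK).
suff -> : (char_ker + <[a]>)%VS = fullv; first exact: dim_cV.
apply/eqP; rewrite eqEsubv subvf; apply/subvP => u _.
have [t ut] := char_ker_shift u aK.
by rewrite -[u](addrK (t *: a)) memv_add // -scaleNr memvZ ?memv_line.
Qed.

Lemma sum_char_vspace (Y : {vspace 'cV[F]_n}) :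
  (Y <= char_ker)%VS -> \sum_(a in Y) psi a = #|F|%:R ^+ \dim Y.
Proof.
move/char_kerP => Y1; rewrite (eq_bigr (fun=> 1)) // sumr_const card_vspace.
by rewrite natrX.
Qed.

End AdditiveCharacter.

(** * Schubert normal form of a hyperplane *)

Section HyperplaneMatrix.
Variable F : finFieldType.

(** The pivot rows [r j] form an identity matrix, so [x] can be read off [M *m x]. *)
Lemma schubert_form_lker n k (M : 'M[F]_(n, k)) : schubert_form M ->
  lker (linfun (mulmx M : 'cV[F]_k -> 'cV[F]_n)) == 0%VS.
Proof.
case/existsP=> r /and3P[_ _ /forallP rM]; rewrite -subv0; apply/subvP => x.
rewrite memv_ker lfunE /= memv0 => /eqP Mx0; apply/eqP/matrixP => j z.
have /matrixP/(_ (r j) z) := Mx0; rewrite !mxE => <-.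
rewrite (bigD1 j) //= big1 => [|l lj]; last first.
  by have /forallP/(_ l)/eqP -> := rM j; rewrite eq_sym (negPf lj) mul0r.
by have /forallP/(_ j)/eqP -> := rM j; rewrite eqxx mul1r addr0.
Qed.

(* The row without pivot is the first i0 such that e_i0 is not in X, and the
   other entries of that row express each e_j modulo X as a multiple of e_i0. *)
Lemma schubert_hyperplane n (X : {vspace 'cV[F]_n}) : (\dim X).+1 = n ->
  exists2 M : 'M[F]_(n, n.-1), schubert_form M &
    limg (linfun (mulmx M : 'cV[F]_n.-1 -> 'cV[F]_n)) = X.
Proof.
case: n X => // n X [dX]; pose e i : 'cV[F]_n.+1 := delta_mx i 0.
have [i0' Xi0'] : exists i, e i \notin X.
  apply/existsP; rewrite -negb_forall; apply: contra_eqN dX => /forallP eX.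
  suff -> : X = fullv; first by rewrite dim_cV neq_ltn ltnSn orbT.
  apply/eqP; rewrite eqEsubv subvf; apply/subvP => u _.
  rewrite [u]matrix_sum_delta; apply: memv_suml => i _.
  by apply: memv_suml => j _; rewrite ord1 memvZ //; exact: eX.
have [i0 Xi0 i0min] := @arg_minnP _ i0' (fun i => e i \notin X) val Xi0'.
have full : (X + <[e i0]>)%VS = fullv.
  by apply/eqP; rewrite eqEdim subvf dim_addv_line // dX dim_cV /=.
(* For [j < i0], minimality of [i0] puts [e j] itself in [X]. The coefficient 0 chosen there makes
   the entry of row [i0] vanish when it lies below the pivot of its column. *)
have /fin_all_exists[c cP] j :
    exists k, (e j - k *: e i0 \in X) /\ ((j < i0)%N -> k = 0).
  have [ji0|ji0] := ltnP j i0.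
    exists 0; rewrite scale0r subr0; split=> //.
    by apply: contraLR ji0 => /i0min; rewrite -leqNgt.
  have := memvf (e j); rewrite -full => /memv_addP[x xX [_ /vlineP[k ->] ejE]].
  by exists k; rewrite ejE addrK.
pose M : 'M[F]_(n.+1, n) :=
  \matrix_(i, j) ((i == lift i0 j)%:R - c (lift i0 j) * (i == i0)%:R).
have sM : schubert_form M.
  apply/existsP; exists [ffun j => lift i0 j]; apply/and3P; split.
  - apply/forallP => j; apply/forallP => l; apply/implyP => jl.
    by rewrite !ffunE /= ltnNge leq_bump2 -ltnNge.
  - apply/forallP => j; apply/forallP => i; apply/implyP.
    rewrite !ffunE mxE => ij; have /negPf -> : i != lift i0 j.
      by rewrite -val_eqE gtn_eqF.
    have [ii0|_] := eqVneq i i0; last by rewrite mulr0 subr0 eqxx.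
    by rewrite ii0 in ij; rewrite (cP _).2 ?mul0r ?subr0.
  - apply/forallP => j; apply/forallP => l; rewrite !ffunE mxE.
    rewrite (inj_eq lift_inj) [lift _ _ == i0]eq_sym (negPf (neq_lift _ _)).
    by rewrite mulr0 subr0.
exists M => //; apply/eqP; rewrite eqEdim; apply/andP; split; last first.
  by rewrite dim_limg_ker0 ?schubert_form_lker ?dim_cV ?dX.
apply/subvP => _ /memv_imgP[x _ ->]; rewrite lfunE /=.
have -> : M *m x = \sum_j x j 0 *: (e (lift i0 j) - c (lift i0 j) *: e i0).
  apply/matrixP => i z; rewrite !mxE summxE; apply: eq_bigr => j _.
  by rewrite ord1 !mxE !andbT mulrC.
by apply: memv_suml => j _; rewrite memvZ // (cP _).1.
Qed.

Lemma Mmx_spec n (X : {vspace 'cV[F]_n}) : (\dim X).+1 = n ->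
  schubert_form (Mmx X) /\
    limg (linfun (mulmx (Mmx X) : 'cV[F]_n.-1 -> 'cV[F]_n)) = X.
Proof.
move=> dX; rewrite /Mmx; case: pickP => [M /andP[sM /eqP MX] //|no].
by have [M sM MX] := schubert_hyperplane dX; have := no M; rewrite sM MX eqxx.
Qed.

End HyperplaneMatrix.

(** * Coordinates in a free vector space *)

Section FreeSpace.
Variables (C : numClosedFieldType) (S : finType).

Lemma bvec_sum (v : {ffun S -> C^o}) : v = \sum_s (v s : C) *: bvec C s.
Proof.
apply/ffunP => t; rewrite sum_ffunE (bigD1 t) //= big1 => [|s st].
  by rewrite !ffunE eqxx addr0 [_ *: _]mulr1.
by rewrite !ffunE eq_sym (negPf st) [_ *: _]mulr0.
Qed.

Lemma lfun_bvecP (V : vectType C) (f g : 'Hom({ffun S -> C^o}, V)) :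
  (forall s, f (bvec C s) = g (bvec C s)) -> f = g.
Proof.
move=> fg; apply/lfunP => v; rewrite (bvec_sum v) !linear_sum.
by apply: eq_bigr => s _; rewrite !linearZ /= fg.
Qed.

End FreeSpace.

(** * Subspaces not contained in the coordinate hyperplane, and translations *)

Section Hats.
Variables (F : finFieldType) (n : nat).
Implicit Types (a b : 'cV[F]_n) (Y : {vspace 'cV[F]_n}).
Implicit Types Z : {vspace 'cV[F]_(n + 1)}.

(** Its intersection with [limg incl] is the copy of [Y], and only the class of [a] modulo [Y]
    matters. The pairs [(a, Y)] thus parametrize [Bbd], with repetitions. *)
Definition hat_at a Y : {vspace 'cV[F]_(n + 1)} :=
  (incl F n @: Y + <[col_mx a 1%:M]>)%VS.

Lemma hatE Y : hat Y = hat_at 0 Y. Proof. by []. Qed.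

Lemma inclE a : incl F n a = col_mx a 0. Proof. by rewrite lfunE. Qed.

Lemma lker_incl : lker (incl F n) == 0%VS.
Proof. by apply/lker0P => a b; rewrite !inclE => /eq_col_mx[]. Qed.

Lemma mem_hat_at a Y x :
  (x \in hat_at a Y) = (usubmx x - dsubmx x 0 0 *: a \in Y).
Proof.
apply/memv_addP/idP => [[_ /memv_imgP[y yY ->] [_ /vlineP[k ->] ->]]|xY].
  rewrite inclE scale_col_mx add_col_mx col_mxKu col_mxKd.
  by rewrite !mxE mulr1 add0r addrK.
exists (incl F n (usubmx x - dsubmx x 0 0 *: a)); first exact: memv_img.
exists (dsubmx x 0 0 *: col_mx a 1%:M); first exact/memvZ/memv_line.
rewrite inclE scale_col_mx add_col_mx subrK add0r -[LHS]vsubmxK.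
by rewrite [in LHS](mx11_scalar (dsubmx x)) scalemx1.
Qed.

Lemma mem_limg_incl x : (x \in limg (incl F n)) = (dsubmx x 0 0 == 0).
Proof.
apply/memv_imgP/eqP => [[y _ ->]|x0]; first by rewrite inclE col_mxKd mxE.
exists (usubmx x); first exact: memvf.
by rewrite inclE -[LHS]vsubmxK (mx11_scalar (dsubmx x)) x0 raddf0.
Qed.

Lemma hat_at_sub a b Y Y' :
  (hat_at a Y <= hat_at b Y')%VS = (Y <= Y')%VS && (a - b \in Y').
Proof.
rewrite subv_add -memvE mem_hat_at col_mxKu col_mxKd mxE scale1r.
congr (_ && _); apply/subvP/subvP => [YY' y yY | YY' _ /memv_imgP[y yY ->]].
  have := YY' _ (memv_img (incl F n) yY).
  by rewrite mem_hat_at inclE col_mxKu col_mxKd mxE scale0r subr0.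
by rewrite mem_hat_at inclE col_mxKu col_mxKd mxE scale0r subr0 YY'.
Qed.

Lemma hat_at_eq a b Y Y' :
  (hat_at a Y == hat_at b Y') = (Y == Y') && (a - b \in Y).
Proof.
rewrite !eqEsubv !hat_at_sub -(memvN _ (b - a)) opprB.
apply/andP/andP => [[/andP[-> _] /andP[-> ->]] //|[/andP[YY' Y'Y] abY]].
by rewrite YY' Y'Y abY (subvP YY').
Qed.

Lemma dim_hat_at a Y : \dim (hat_at a Y) = (\dim Y).+1.
Proof.
rewrite dim_addv_line; last first.
  apply/negP => /(subvP (limgS _ (subvf Y))).
  by rewrite mem_limg_incl col_mxKd mxE oner_eq0.
by rewrite dim_limg_ker0 ?lker_incl.
Qed.

Lemma hat_at_Bbd a Y : hat_at a Y \in Bbd F n.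
Proof.
rewrite inE; apply/subvPn; exists (col_mx a 1%:M).
  by rewrite mem_hat_at col_mxKu col_mxKd mxE scale1r subrr mem0v.
by rewrite mem_limg_incl col_mxKd mxE oner_eq0.
Qed.

(** A vector of [Z] outside the hyperplane, rescaled to have last coordinate 1, provides [a]; the
    preimage of [Z] under [incl] provides [Y]. *)
Lemma Bbd_hat_at Z : Z \in Bbd F n -> exists a Y, Z = hat_at a Y.
Proof.
rewrite inE => /subvPn[z zZ]; rewrite mem_limg_incl => z0.
pose d := dsubmx z 0 0; pose a := d^-1 *: usubmx z.
have aZ : col_mx a 1%:M \in Z.
  suff -> : col_mx a 1%:M = d^-1 *: z by rewrite memvZ.
  rewrite -[z in RHS]vsubmxK scale_col_mx; congr col_mx.
  by rewrite (mx11_scalar (dsubmx z)) -/d scale_scalar_mx mulVf.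
exists a, (incl F n @^-1: Z)%VS; apply/vspaceP => x.
rewrite mem_hat_at -memv_preim inclE.
rewrite -(rpredBr _ (memvZ (dsubmx x 0 0) aZ)); congr (_ \in Z).
rewrite scale_col_mx -[x in LHS]vsubmxK opp_col_mx add_col_mx; congr col_mx.
  by rewrite col_mxKd.
by rewrite col_mxKd [X in X - _]mx11_scalar scalemx1 subrr.
Qed.

Lemma act_subM g h Z : act_sub g (act_sub h Z) = act_sub (g *m h) Z.
Proof.
rewrite /act_sub -limg_comp; apply: eq_in_limg => x _.
by rewrite comp_lfunE !lfunE /= mulmxA.
Qed.

Lemma act_sub_HmxK a : cancel (act_sub (Hmx a)) (act_sub (Hmx (- a))).
Proof.
move=> Z; rewrite act_subM HmxM addNr Hmx0; apply/vspaceP => x.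
apply/memv_imgP/idP => [[y yZ ->]|xZ]; first by rewrite lfunE /= mul1mx.
by exists x; rewrite ?lfunE /= ?mul1mx.
Qed.

Lemma Hmx_lker a : lker (linfun (mulmx (Hmx a) : 'cV[F]_(n + 1) -> _)) == 0%VS.
Proof.
apply/lker0P => x y; rewrite !lfunE /= => /(congr1 (mulmx (Hmx (- a)))).
by rewrite !mulmxA HmxM addNr Hmx0 !mul1mx.
Qed.

Lemma act_sub_incl b Y : act_sub (Hmx b) (incl F n @: Y) = (incl F n @: Y)%VS.
Proof.
rewrite /act_sub -limg_comp; apply: eq_in_limg => x _.
rewrite comp_lfunE lfunE /= !inclE /Hmx mul_block_col.
by rewrite mul1mx !mulmx0 mul0mx !addr0.
Qed.

Lemma act_sub_hat_at b a Y : act_sub (Hmx b) (hat_at a Y) = hat_at (a + b) Y.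
Proof.
rewrite /hat_at /act_sub limgD limg_line; congr (_ + <[_]>)%VS.
  exact: act_sub_incl.
by rewrite lfunE /= /Hmx mul_block_col mul1mx !mulmx1 mul0mx add0r.
Qed.

(** The pairs giving the same subspace as [(b, Y)] are the [(a, Y)] with [a] in the coset of [b]
    modulo [Y]. There are q to the power [\dim Y] of them, which the weight compensates. *)
Lemma sum_Bbd (C : numClosedFieldType) (V : lmodType C)
    (f : {vspace 'cV[F]_(n + 1)} -> V) :
  \sum_(Z in Bbd F n) f Z =
  \sum_Y #|F|%:R ^- \dim Y *: \sum_a f (hat_at a Y).
Proof.
have q0 : #|F|%:R != 0 :> C by rewrite pnatr_eq0 (cardD1 0) inE.
under [RHS]eq_bigr do rewrite scaler_sumr.
rewrite pair_big /=.
rewrite (partition_big (fun p => hat_at p.2 p.1) (mem (Bbd F n))) /=.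
  apply: eq_bigr => _ /Bbd_hat_at[b [Y ->]]; apply/esym.
  rewrite (eq_bigl (fun p => (p.1 == Y) && (p.2 - b \in Y))); last first.
    by move=> [Y' a] /=; rewrite hat_at_eq; case: eqP => [->|].
  rewrite -(pair_big_dep (pred1 Y) (fun _ a => a - b \in Y)
     (fun Y a => #|F|%:R ^- \dim Y *: f (hat_at a Y))) /= big_pred1_eq.
  rewrite (reindex_inj (addIr b)) /=.
  rewrite (eq_bigr (fun=> #|F|%:R ^- \dim Y *: f (hat_at b Y))); last first.
    move=> a; rewrite addrK => aY; congr (_ *: f _); apply/eqP.
    by rewrite hat_at_eq eqxx addrK.
  rewrite (eq_bigl (mem Y)) => [|a]; last by rewrite addrK.
  rewrite sumr_const card_vspace -scaler_nat natrX scalerA divff ?scale1r //.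
  by rewrite expf_neq0.
by move=> p _; apply: hat_at_Bbd.
Qed.

End Hats.

(** * The operator p(chi), its values on subspaces, and its commutation with the adjacency
    operator *)

Section Isotypic.
Variables (C : numClosedFieldType) (F : finFieldType) (n : nat).
Variables (phi : C) (chi : 'M[F]_(n + 1) -> C).
Hypothesis chiH : H_char chi.
Let q : C := #|F|%:R.
Let psi (a : 'cV[F]_n) : C := chi (Hmx a).
Let P := pchi chi.
Implicit Types (a b : 'cV[F]_n) (Y : {vspace 'cV[F]_n}).

Let q_neq0 : q != 0. Proof. by rewrite pnatr_eq0 (cardD1 0) inE. Qed.

Lemma Hchar0 : psi 0 = 1. Proof. by rewrite /psi Hmx0 chiH.1. Qed.

Lemma HcharD : {morph psi : a b / a + b >-> a * b}.
Proof. by move=> a b; rewrite /psi -HmxM chiH.2 ?imset_f. Qed.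

Notation K := (char_ker psi).
Let psi_conj := add_char_conj Hchar0 HcharD.

Lemma Hmx_inj : injective (@Hmx F n).
Proof. by move=> a b /eq_block_mx[]. Qed.

Lemma act_bvec (g : 'M[F]_(n + 1)) Z :
  act C g (bvec C Z) = bvec C (act_sub g Z).
Proof. exact: basis_extE. Qed.

Lemma pchiE v : P v = \sum_a (psi a)^* *: act C (Hmx a) v.
Proof.
rewrite /P /pchi big_imset => [|a b _ _ /Hmx_inj //].
rewrite sum_lfunE; apply: eq_bigr => a _; exact: scale_lfunE.
Qed.

Lemma pchi_hat_sum a Y : P (bvec C (hat_at a Y)) =
  \sum_b (psi b)^* *: bvec C (hat_at (a + b) Y).
Proof.
rewrite pchiE; apply: eq_bigr => b _.
by rewrite act_bvec act_sub_hat_at.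
Qed.

Lemma pchi_hat_at a Y :
  P (bvec C (hat_at a Y)) = psi a *: P (bvec C (hat_at 0 Y)).
Proof.
rewrite !pchi_hat_sum scaler_sumr (reindex_inj (addrI (- a))) /=.
apply: eq_bigr => b _; rewrite addNKr add0r [RHS]scalerA.
by rewrite !psi_conj -HcharD opprD opprK.
Qed.

(** For [b] in [Y] with [psi b != 1], the subspaces [hat_at b Y] and [hat_at 0 Y] coincide, so the
    image of [hat_at 0 Y] equals [psi b] times itself. *)
Lemma pchi_hat_eq0 a Y : ~~ (Y <= K)%VS -> P (bvec C (hat_at a Y)) = 0.
Proof.
move=> YK; rewrite pchi_hat_at.
have [b bY b1] : exists2 b, b \in Y & psi b != 1.
  apply/exists_inP; apply: contraR YK; rewrite negb_exists_in => /forall_inP Y1.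
  by apply/(char_kerP Hchar0 HcharD) => u /Y1; rewrite negbK => /eqP.
have : P (bvec C (hat_at b Y)) = P (bvec C (hat_at 0 Y)).
  by congr (P (bvec C _)); apply/eqP; rewrite hat_at_eq eqxx subr0.
rewrite pchi_hat_at => /eqP; rewrite -subr_eq0 -[X in _ - X]scale1r -scalerBl.
by rewrite scaler_eq0 subr_eq0 (negPf b1) => /eqP ->; rewrite scaler0.
Qed.

(** Translations fix every subspace of the hyperplane, so the sum of a nontrivial character factors
    out. *)
Lemma pchi_incl Y : (exists a, psi a != 1) -> P (bvec C (incl F n @: Y)%VS) = 0.
Proof.
case=> a a1; rewrite pchiE.
under eq_bigr => b _ do rewrite act_bvec act_sub_incl psi_conj.
rewrite -scaler_suml; suff -> : \sum_b psi (- b) = 0 by rewrite scale0r.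
have : psi (- a) * \sum_b psi (- b) = \sum_b psi (- b).
  rewrite mulr_sumr [RHS](reindex_inj (addrI a)) /=; apply: eq_bigr => b _.
  by rewrite -HcharD opprD.
move/eqP; rewrite -subr_eq0 -[X in _ - X]mul1r -mulrBl mulf_eq0 subr_eq0.
rewrite -psi_conj -[X in _ == X]conjC1 (inj_eq (can_inj conjCK)) (negPf a1).
by move/eqP.
Qed.

(** The translate by [b] of [hat_at 0 Y] is [hat_at 0 Y'] only if [Y' = Y] and [b] lies in [Y],
    where [psi] is 1. The coefficient then counts the elements of [Y]. *)
Lemma pchi_hat_coef Y Y' : (Y <= K)%VS ->
  P (bvec C (hat_at 0 Y)) (hat_at 0 Y') = (Y' == Y)%:R * q ^+ \dim Y.
Proof.
move=> YK; rewrite pchi_hat_sum sum_ffunE.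
under eq_bigr => b _ do rewrite !ffunE hat_at_eq !add0r memvN.
case: eqP => [->|_]; last first.
  by rewrite mul0r big1 // => b _; rewrite [_ *: _]mulr0.
rewrite mul1r -(sum_char_vspace Hchar0 HcharD YK) [RHS]big_mkcond /=.
apply: eq_bigr => b _; rewrite psi_conj [_ *: _]mulrC.
have /(char_kerP Hchar0 HcharD) Y1 := YK.
by case: ifP => bY; rewrite ?mul0r // mul1r !Y1 ?memvN.
Qed.

Lemma calA_bvec m (Y : {vspace 'cV[F]_m}) :
  calA F m phi (bvec C Y) = \sum_Z A_coef phi Z Y *: bvec C Z.
Proof. exact: basis_extE. Qed.

Lemma A_coef_limg m1 m2 (f : 'Hom('cV[F]_m1, 'cV[F]_m2))
    (Z Y : {vspace 'cV[F]_m1}) :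
  lker f == 0%VS -> A_coef phi (f @: Z)%VS (f @: Y)%VS = A_coef phi Z Y.
Proof.
by move=> fK; rewrite /A_coef !limg_ker0 // eq_limg_ker0 // !dim_limg_ker0.
Qed.

(** Translations are linear automorphisms, so they preserve the inclusions and dimensions that
    define the coefficients. *)
Lemma calA_act a v :
  calA F (n + 1) phi (act C (Hmx a) v) = act C (Hmx a) (calA F (n + 1) phi v).
Proof.
suff : (calA F (n + 1) phi \o act C (Hmx a) =
          act C (Hmx a) \o calA F (n + 1) phi)%VF.
  by move/lfunP/(_ v); rewrite !comp_lfunE.
apply: lfun_bvecP => Y; rewrite !comp_lfunE act_bvec !calA_bvec linear_sum /=.
rewrite (reindex_inj (can_inj (act_sub_HmxK a))) /=; apply: eq_bigr => Z _.
by rewrite linearZ /= act_bvec /act_sub A_coef_limg ?Hmx_lker.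
Qed.

Lemma calA_pchi v : calA F (n + 1) phi (P v) = P (calA F (n + 1) phi v).
Proof.
rewrite !pchiE linear_sum; apply: eq_bigr => a _.
by rewrite linearZ /= calA_act.
Qed.

Lemma sum_char_indic (U : {vspace 'cV[F]_n}) (c : C) (G : 'cV[F]_n -> C) :
    (U <= K)%VS -> (forall a, G a = if a \in U then c else 0) ->
  \sum_a psi a * G a = q ^+ \dim U * c.
Proof.
move=> UK GE; rewrite -(sum_char_vspace Hchar0 HcharD UK) mulr_suml.
rewrite [RHS]big_mkcond /=; apply: eq_bigr => a _.
by rewrite GE; case: ifP => // _; rewrite mulr0.
Qed.

(** The two hats are related as [Y'] and [Y] are, provided that [a] lies in the larger of these, so
    the sum yields q to the power of its dimension. Going up, this power is already [(\dim Y).+1].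
    Going down or staying level, the missing factor q comes from the coefficient, as hats have
    dimension one more. *)
Lemma sum_char_A_coef Y Y' : (Y <= K)%VS -> (Y' <= K)%VS ->
  \sum_a psi a * A_coef phi (hat_at a Y') (hat_at 0 Y) =
  q ^+ (\dim Y).+1 * A_coef phi Y' Y.
Proof.
move=> YK Y'K; rewrite {2}/A_coef.
have AE a : A_coef phi (hat_at a Y') (hat_at 0 Y) =
    if [&& Y <= Y', a \in Y' & \dim Y' == (\dim Y).+1]%VS then 1
    else if [&& Y' <= Y, a \in Y & \dim Y == (\dim Y').+1]%VS
    then phi * q ^+ (\dim Y').+1
    else if (Y' == Y) && (a \in Y)
    then (phi - 1) / (q - 1) * q ^+ (\dim Y).+1 else 0.
  rewrite /A_coef !hat_at_sub !dim_hat_at !eqSS hat_at_eq sub0r memvN subr0.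
  by rewrite -!andbA; case: (eqVneq Y' Y) => [->|].
have [/andP[YY' dY']|up] := boolP (_ && _).
  rewrite -(eqP dY') (sum_char_indic (c := 1) Y'K) // => a.
  rewrite AE YY' dY' andbT /= (eqP dY').
  rewrite (_ : (\dim Y == _) = false) ?andbF; last by rewrite ltn_eqF // ltnW.
  case: eqP => [YE|_ //]; move: dY'; rewrite YE => /eqP/n_Sn[].
have [/andP[Y'Y dY]|down] := boolP (_ && _).
  rewrite (sum_char_indic (c := phi * q ^+ (\dim Y').+1) YK) => [|a].
    by rewrite (eqP dY) !exprS; ring.
  rewrite AE Y'Y dY andbT /= (eqP dY) (_ : (\dim Y' == _) = false) ?andbF //.
    case: ifP => // _; case: eqP => [YE|_ //].
    by move: dY; rewrite YE => /eqP/n_Sn[].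
  by rewrite ltn_eqF // ltnW.
have AE2 a : A_coef phi (hat_at a Y') (hat_at 0 Y) =
    if (Y' == Y) && (a \in Y)
    then (phi - 1) / (q - 1) * q ^+ (\dim Y).+1 else 0.
  rewrite AE andbCA (negPf up) andbF andbCA (negPf down) andbF //.
case: eqP AE2 => [->|_] AE2.
  by rewrite (sum_char_indic YK AE2) !exprS; ring.
by rewrite mulr0 big1 // => a _; rewrite AE2 mulr0.
Qed.

Lemma CBbd_sum v : v \in CBbd C F n ->
  v = \sum_(Z in Bbd F n) (v Z : C) *: bvec C Z.
Proof.
move=> vB; rewrite {1}(bvec_sum v) [RHS]big_mkcond /=; apply: eq_bigr => Z _.
case: ifP => // ZB; suff -> : v Z = 0 by rewrite scale0r.
have /memv_sumP[w wP ->] := vB; rewrite sum_ffunE big1 // => Y YB.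
have /vlineP[k ->] := wP _ YB; rewrite !ffunE.
by case: eqP ZB => [->|_ _]; rewrite ?YB // [_ *: _]mulr0.
Qed.

Lemma CBbd_bvec a Y : bvec C (hat_at a Y) \in CBbd C F n.
Proof. by rewrite memvE (sumv_sup (hat_at a Y)) // hat_at_Bbd. Qed.

Lemma pchi_hat_W Y : P (bvec C (hat_at 0 Y)) \in W chi.
Proof.
apply/memW; split.
  by rewrite pchi_hat_sum; apply: memv_suml => a _; rewrite memvZ // CBbd_bvec.
move=> _ /imsetP[b _ ->]; rewrite -/(psi b) pchi_hat_sum linear_sum scaler_sumr.
rewrite [RHS](reindex_inj (addrI b)) /=; apply: eq_bigr => a _.
rewrite !add0r linearZ [RHS]scalerA /= act_bvec act_sub_hat_at [a + b]addrC.
by rewrite !psi_conj -HcharD opprD addrA addrN add0r.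
Qed.

(** On [W chi], each summand of p(chi) multiplies by the conjugate of [psi a] times [psi a], which
    is 1. *)
Lemma pchi_W v : v \in W chi -> P v = #|{: 'cV[F]_n}|%:R *: v.
Proof.
move=> /memW[_ vW]; rewrite pchiE scaler_nat -sumr_const; apply: eq_bigr => a _.
by rewrite vW ?imset_f // scalerA psi_conj -HcharD addNr Hchar0 scale1r.
Qed.

End Isotypic.

(** * Identification of X(chi) and of the composition lambda mu *)

Section Hyperplane.
Variables (C : numClosedFieldType) (F : finFieldType) (n : nat).
Variable chi : 'M[F]_(n + 1) -> C.
Hypothesis chiN : nontrivial_H_char chi.
Let psi (a : 'cV[F]_n) : C := chi (Hmx a).
Let chiH : H_char chi := chiN.1.

Lemma psi_nontrivial : exists a, psi a != 1.
Proof. by case: chiN => _ [_ /imsetP[a _ ->] a1]; exists a. Qed.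

Lemma dim_psi_ker : (\dim (char_ker psi)).+1 = n.
Proof.
exact: dim_char_ker (Hchar0 chiH) (HcharD chiH) psi_nontrivial.
Qed.

Lemma Xchi_ker : Xchi chi = char_ker psi.
Proof.
have dK := dim_psi_ker; rewrite /Xchi.
case: pickP => [X /andP[/eqP dX PX]|/(_ (char_ker psi))] /=.
  apply/eqP; rewrite eqEdim -[X in (X <= _)%N]/((\dim _).+1.-1) dK dX.
  rewrite leqnn andbT.
  by apply: contraNT PX => XK; rewrite hatE pchi_hat_eq0.
(* The default value would require the kernel itself to be rejected, but its image has the nonzero
   coefficient q to the power of its dimension at its own hat. *)
rewrite -[X in X.-1]dK eqxx /= => /negbFE/eqP P0.
have := pchi_hat_coef chiH (char_ker psi) (subvv _).
rewrite -hatE P0 ffunE eqxx mul1r => /esym/eqP.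
by rewrite expf_eq0 pnatr_eq0 (cardD1 0) inE andbF.
Qed.

Let X := Xchi chi.
(** This is [tau X] followed by the inclusion of [X], which avoids computing inside [subvs_of X]. *)
Let L := linfun (mulmx (Mmx X) : 'cV[F]_n.-1 -> 'cV[F]_n).

Lemma limg_Mmx : lker L == 0%VS /\ limg L = char_ker psi.
Proof.
have [|sM limgL] := @Mmx_spec F n X; first by rewrite /X Xchi_ker dim_psi_ker.
by split; [exact: schubert_form_lker | rewrite /L limgL /X Xchi_ker].
Qed.

Lemma vsval_tau x : vsval (tau X x) = L x.
Proof.
have : L x \in X by rewrite /X Xchi_ker -limg_Mmx.2 memv_img ?memvf.
by rewrite !lfunE /= => LX; rewrite vsprojK.
Qed.

Lemma lambda_muE Y : (lambda chi \o mu C X)%VF (bvec C Y) =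
  #|F|%:R ^- \dim Y *: pchi chi (bvec C (hat (L @: Y)%VS)).
Proof.
rewrite comp_lfunE /mu basis_extE /lambda basis_extE -limg_comp.
have tauK : lker (tau X) == 0%VS.
  have /lker0P Linj := limg_Mmx.1; apply/lker0P => x y xy; apply: Linj.
  by rewrite -!vsval_tau xy.
have -> : \dim (tau X @: Y) = \dim Y.
  exact: dim_limg_ker0.
congr (_ *: pchi chi (bvec C (hat _))); apply: eq_in_limg => x _.
by rewrite comp_lfunE -vsval_tau lfunE.
Qed.

End Hyperplane.

(** * Bijectivity onto W(chi) and the intertwining relation *)

Section Intertwining.
Variables (C : numClosedFieldType) (F : finFieldType) (n m : nat).
Variables (phi : C) (chi : 'M[F]_(n + 1) -> C).
Hypothesis chiN : nontrivial_H_char chi.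
Let q : C := #|F|%:R.
Let psi (a : 'cV[F]_n) : C := chi (Hmx a).
Let P := pchi chi.
Variable L : 'Hom('cV[F]_m, 'cV[F]_n).
Hypotheses (LK : lker L == 0%VS) (limgL : limg L = char_ker psi).
Variable T : 'Hom(CB C 'cV[F]_m, CB C 'cV[F]_(n + 1)).
Hypothesis TE : forall Y,
  T (bvec C Y) = q ^- \dim Y *: P (bvec C (hat (L @: Y)%VS)).
Let chiH : H_char chi := chiN.1.
Let q_neq0 : q != 0. Proof. by rewrite pnatr_eq0 (cardD1 0) inE. Qed.

Lemma limg_sub_char_ker Y : (L @: Y <= char_ker psi)%VS.
Proof. by rewrite -limgL limgS ?subvf. Qed.

(** Each coordinate of [v] reappears in [T v], because the normalization of [T] cancels the
    coefficient from [pchi_hat_coef]. Injectivity follows. *)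
Lemma intertwiner_coef v Y : T v (hat (L @: Y)%VS) = v Y.
Proof.
rewrite {1}(bvec_sum v) linear_sum sum_ffunE (bigD1 Y) //= big1 ?addr0.
  rewrite linearZ /= TE !ffunE hatE pchi_hat_coef ?limg_sub_char_ker //.
  rewrite eqxx mul1r dim_limg_ker0 //.
  by rewrite [_ *: _]mulrA mulfVK // expf_neq0.
move=> Y' YY'; rewrite linearZ /= TE !ffunE hatE.
rewrite pchi_hat_coef ?limg_sub_char_ker //.
by rewrite eq_limg_ker0 // eq_sym (negPf YY') mul0r !scaler0.
Qed.

Lemma intertwiner_lker : lker T = 0%VS.
Proof.
apply/eqP; rewrite -subv0; apply/subvP => v; rewrite memv_ker memv0 => /eqP v0.
by apply/eqP/ffunP => Y; rewrite -intertwiner_coef v0 !ffunE.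
Qed.

Lemma pchi_hat_limg a Y : P (bvec C (hat_at a Y)) \in limg T.
Proof.
have [YK|YK] := boolP (Y <= char_ker psi)%VS; last first.
  by rewrite pchi_hat_eq0 ?mem0v.
rewrite /P pchi_hat_at // memvZ // -(lpreimK (W := Y) (f := L)) ?limgL //.
set Y' := (L @^-1: Y)%VS.
have -> : pchi chi (bvec C (hat_at 0 (L @: Y')%VS)) =
          T (q ^+ \dim Y' *: bvec C Y').
  by rewrite linearZ /= TE scalerA divff ?scale1r // expf_neq0.
by rewrite memv_img ?memvf.
Qed.

(** For surjectivity, a nonzero multiple of [v] in [W chi] is p(chi) applied to [v], and [v] is a
    combination of subspaces [hat_at a Y], whose images lie in [limg T]. *)
Lemma intertwiner_limg : limg T = W chi.
Proof.
apply/eqP; rewrite eqEsubv; apply/andP; split; apply/subvP => v.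
  move=> /memv_imgP[w _ ->].
  rewrite (bvec_sum w) linear_sum memv_suml // => Y _.
  by rewrite linearZ /= TE !memvZ // pchi_hat_W.
move=> vW; have c0 : #|{: 'cV[F]_n}|%:R != 0 :> C.
  by rewrite pnatr_eq0 (cardD1 0) inE.
rewrite -[v](scalerK c0) -(pchi_W chiH vW) memvZ //.
have /memW[/CBbd_sum -> _] := vW; rewrite linear_sum memv_suml // => Z.
by move=> /Bbd_hat_at[a [Y ->]]; rewrite linearZ memvZ // pchi_hat_limg.
Qed.

Lemma intertwiner_calA v : T (q *: calA F m phi v) = calA F (n + 1) phi (T v).
Proof.
suff : (T \o (q *: calA F m phi) = calA F (n + 1) phi \o T)%VF.
  by move/lfunP/(_ v); rewrite !comp_lfunE scale_lfunE.
apply: lfun_bvecP => Y; rewrite !comp_lfunE scale_lfunE calA_bvec.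
rewrite linearZ linear_sum /=.
rewrite TE linearZ /= calA_pchi // calA_bvec.
(* The subspaces inside the hyperplane, produced when the operator lowers dimension, are killed by
   p(chi). *)
rewrite [X in _ = _ *: X]linear_sum (bigID (mem (Bbd F n))) /=.
rewrite [X in _ + X]big1 ?addr0; last first.
  move=> Z; rewrite inE negbK => /lpreimK <-.
  rewrite linearZ /= pchi_incl ?scaler0 //.
  exact: psi_nontrivial chiN.
rewrite sum_Bbd [RHS]scaler_sumr.
(* Only the [Y'] inside the kernel survive p(chi), and these are exactly the images under [L] of the
   subspaces of the source. *)
rewrite [RHS](bigID (fun Y' : {vspace 'cV[F]_n} => Y' <= limg L)%VS) /=.
rewrite [X in _ + X]big1 ?addr0; last first.
  move=> Y' Y'L; rewrite big1 ?scaler0 // => a _.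
  by rewrite linearZ /= pchi_hat_eq0 ?scaler0 // -limgL.
rewrite [RHS](reindex (lfun_img L)) /=; last first.
  exists (fun Y' => (L @^-1: Y')%VS) => Y'; last by move=> /lpreimK.
  move=> _; apply/eqP.
  by rewrite -(eq_limg_ker0 _ _ LK) lpreimK // limgS ?subvf.
rewrite scaler_sumr; apply: eq_big => [Y'|Y' _]; first by rewrite limgS ?subvf.
under [in RHS]eq_bigr => a _ do rewrite linearZ /= pchi_hat_at // scalerA mulrC.
rewrite -scaler_suml sum_char_A_coef ?limg_sub_char_ker //.
rewrite A_coef_limg // !dim_limg_ker0 //.
rewrite linearZ /= TE hatE !scalerA; congr (_ *: _).
(* The factor q of the relation is what remains of q to the power [(\dim Y).+1] after the
   normalization of [T] at [Y]. *)
rewrite -/q exprS; move: (expf_neq0 (\dim Y) q_neq0) => qY0.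
have := expf_neq0 (\dim Y') q_neq0 => qY'0.
by field; rewrite qY0 qY'0.
Qed.

End Intertwining.

(** * The theorem over the complex numbers *)

Local Open Scope complex_scope.

Theorem theorem3p2 (R : realType) (F : finFieldType) (phi : R) (phi_gt0 : 0 < phi)
    (n : nat) (n_gt0 : (0 < n)%N) (chi : 'M[F]_(n + 1) -> R[i])
    (chiN : nontrivial_H_char chi) :
  let T : 'Hom(CB R[i] 'cV[F]_n.-1, CB R[i] 'cV[F]_(n + 1)) :=
    (lambda chi \o mu R[i] (Xchi chi))%VF in
  [/\ lker T = 0%VS,
      limg T = W chi,
      forall v : CB R[i] 'cV[F]_n.-1,
        T (#|F|%:R *: calA F n.-1 phi%:C v) = calA F (n + 1) phi%:C (T v)
    & (calA F (n + 1) phi%:C @: W chi <= W chi)%VS].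
Proof.
move=> T; have [LK limgL] := limg_Mmx chiN.
have TE := lambda_muE chiN : forall Y, T (bvec _ Y) = _.
have TA := intertwiner_calA phi%:C chiN LK limgL TE.
have TW := intertwiner_limg chiN limgL TE.
have TK := intertwiner_lker chiN LK limgL TE.
split=> //.
rewrite -TW; apply/subvP => _ /memv_imgP[_ /memv_imgP[v _ ->] ->].
by rewrite -TA memv_img ?memvf.
Qed.
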